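(* Let $G$ be a group-action on a locally connected compact Hausdorff space $X$ and let $H$ be a finite index normal subgroup of $G$. Then $G$ is $R$-closed if and only if $H$ is $R$-closed.
   Context: A group-action is a continuous action of a topological group $G$ on a topological space $X$; the group and its action are denoted by the same letter, and a subgroup $H$ acts by restriction. A group-action $G$ on $X$ is $R$-closed if $\{(x,y)\in X\times X\mid y\in\overline{G(x)}\}$ is a closed subset of $X\times X$, where $G(x)$ is the orbit of $x$. *)

(* Defs.v *)
From HB Require Import structures.
From mathcomp Require Import all_boot.
From mathcomp Require Import all_classical topology.

Set Implicit Arguments.
Unset Strict Implicit.
Unset Printing Implicit Defensive.

Local Open Scope classical_set_scope.

(* No separation axiom is required of a topological group. *)
HB.mixin Record isTopologicalGroup G & Topological G & Group G := {
  mulg_continuous : continuous (fun p : G * G => (p.1 * p.2)%g);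
  invg_continuous : continuous (fun g : G => (g^-1)%g)
}.

#[short(type="topologicalGroupType")]
HB.structure Definition TopologicalGroup :=
  {G of Topological G & Group G & isTopologicalGroup G}.

Record continuous_action (G : topologicalGroupType) (X : topologicalType) :=
  ContinuousAction {
    act :> G -> X -> X;
    act1 : forall x, act 1%g x = x;
    actM : forall g h x, act (g * h)%g x = act g (act h x);
    act_continuous : continuous (fun p : G * X => act p.1 p.2)
  }.

(* As for finite group actions in mathcomp.fingroup.action, orbits take the
   acting subset H of G as a parameter: a subgroup acts by restriction, and the
   whole group is [set: G]. *)
Definition orbit (G : topologicalGroupType) (X : topologicalType)
    (a : continuous_action G X) (H : set G) (x : X) : set X :=
  [set a h x | h in H].

Definition R_closed (G : topologicalGroupType) (X : topologicalType)
    (a : continuous_action G X) (H : set G) : Prop :=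
  closed [set p : X * X | closure (orbit a H p.1) p.2].

Definition normal_subgroup (G : groupType) (H : groupClosed G) : Prop :=
  forall g h : G, h \in H -> (h ^ g)%g \in H.

Definition left_coset (G : groupType) (H : set G) (g : G) : set G :=
  [set (g * h)%g | h in H].

Definition finite_index (G : groupType) (H : groupClosed G) : Prop :=
  finite_set (range (left_coset [set` H])).

Definition locally_connected (X : topologicalType) : Prop :=
  forall (x : X) (U : set X), nbhs x U ->
    exists V : set X, [/\ open V, connected V, V x & V `<=` U].

(* Main.v *)
Require Import Defs.
From HB Require Import structures.
From mathcomp Require Import all_boot.
From mathcomp Require Import all_classical topology.

Local Open Scope classical_set_scope.

(** Write [Gx] and [Hx] for the two orbits of [x]. Since [H] has finite index,
the closure of [Gx] is a finite union of sets [g (closure Hx)], one for each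
left coset [gH] ([closure_orbit_cosets]); so the orbit-closure relation of [G]
is a finite union of homeomorphic images of that of [H], and is closed when the
latter is ([R_closed_overgroup]).

Conversely let [G] be R-closed. Its orbit-closure relation is symmetric, and
this passes to [H] ([closure_orbit_subgroup_sym]): some power of every element
of [G] lies in [H]. Hence the [H]-orbit closures partition each [G]-orbit
closure, into finitely many pieces, and the part of [closure Gx] outside
[closure Hx] is closed ([closed_closure_orbitD]). Let [U] and [V] be disjoint
open sets containing [closure Hx] and this remaining part. By compactness the
[G]-orbit closures of the points near [x] stay in the union of [U] and [V]
([closure_orbit_near]). If [W] is a connected neighbourhood of [x] made of such
points, then each translate [hW] with [h] in [H] is connected, lies in this
union and meets [U] at [hx]; so it lies in [U]. Thus no [H]-orbit closure
starting in [W] enters [V], which separates [x] from the points of [V] in the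
orbit-closure relation of [H] ([R_closed_normal_subgroup]). Connectedness of
[W] is what controls all the elements of [H] at once, although [H] may need
infinitely many generators. *)

Set Implicit Arguments.
Unset Strict Implicit.
Unset Printing Implicit Defensive.

(* [orbit] alone would denote the orbits of a function on a finite type. *)
Local Notation orbit := Defs.orbit.

(** Two distinct powers of [k] lie in the same coset, by finiteness. *)
Lemma finite_index_expg (G : groupType) (H : groupClosed G) (k : G) :
  finite_index H -> exists n, (k ^+ n.+1)%g \in H.
Proof.
move=> finH; apply: contrapT => /forallNP kNH; apply: infinite_nat.
have kP i j : (i < j)%N -> left_coset [set` H] (k ^+ i)%g (k ^+ j)%g -> False.
  move=> ij [h /= Hh kij]; apply: (kNH (j - i).-1).
  rewrite prednK ?subn_gt0//.
  suff -> : (k ^+ (j - i))%g = h by [].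
  by apply: (mulgI (k ^+ i)%g); rewrite -expgnDr subnKC// ltnW.
have kk i : left_coset [set` H] (k ^+ i)%g (k ^+ i)%g.
  by exists 1%g; [exact: gpred1 | rewrite mulg1].
pose f n := left_coset [set` H] (k ^+ n)%g.
suff : finite_set (f @^-1` range (left_coset [set` H])).
  by apply: sub_finite_set => n _; exists (k ^+ n)%g.
apply: finite_preimage finH => i j _ _ fij.
case: (ltngtP i j) => // [/kP|/kP]; case.
- by rewrite -/(f i) fij; exact: kk.
- by rewrite -/(f j) -fij; exact: kk.
Qed.

Section OrbitClosures.
Context {G : topologicalGroupType} {X : topologicalType}.
Variable a : continuous_action G X.
Implicit Types (g k : G) (x y z : X) (A B U : set X) (K : set G).

Lemma actK g x : a g^-1%g (a g x) = x.
Proof. by rewrite -actM mulVg act1. Qed.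

Lemma actVK g x : a g (a g^-1%g x) = x.
Proof. by rewrite -actM mulgV act1. Qed.

Lemma continuous_act g : continuous (a g).
Proof.
move=> x; apply: (@continuous_comp _ _ _ (pair g) (fun p => a p.1 p.2)).
  by apply: cvg_pair; [exact: cvg_cst | exact: cvg_id].
exact: act_continuous.
Qed.

Lemma act_closure g A x : closure A x -> closure (a g @` A) (a g x).
Proof.
move=> Ax B /continuous_act /Ax [z [Az Bz]].
by exists (a g z); split => //; exists z.
Qed.

Lemma orbit_left_coset K g x : orbit a (left_coset K g) x = a g @` orbit a K x.
Proof.
apply/seteqP; split=> _ [] _ [k Kk <-] <-; last first.
  by exists (g * k)%g; rewrite ?actM//; exists k.
by exists (a k x); [exists k | rewrite actM].
Qed.

Lemma closure_orbit_left_coset K g x y :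
  closure (orbit a (left_coset K g) x) y <-> closure (orbit a K x) (a g^-1%g y).
Proof.
rewrite orbit_left_coset; split=> [/(@act_closure g^-1%g)|/(@act_closure g)].
  by apply: closureS => _ [_ [z Kz <-] <-]; rewrite actK.
by rewrite actVK.
Qed.

(** Upper semicontinuity of orbit closures: the points [z] whose orbit closure
meets the complement of [U] form the projection of a closed set along the
compact factor [~` U]. *)
Lemma closure_orbit_near K U x : compact [set: X] -> R_closed a K ->
  open U -> closure (orbit a K x) `<=` U ->
  \forall z \near x, closure (orbit a K z) `<=` U.
Proof.
move=> cX RK oU xU.
have cU : compact (~` U).
  by apply: subclosed_compact cX _ => //; exact: open_closedC.
have : \forall z \near x, ~` U `<=` ~` closure (orbit a K z).
  move/compact_near_coveringP : cU.
  apply=> y nUy; have : nbhs (x, y) (~` [set p | closure (orbit a K p.1) p.2]).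
    by apply: open_nbhs_nbhs; split; [exact: closed_openC | move=> /xU].
  move=> [[P Q] /= [Px Qy] PQ]; exists (Q, P) => // -[y' z] [/= Qy' Pz].
  exact: (PQ (z, y')).
by apply: filterS => z; exact: subsetC2.
Qed.

(** For every [z] in the orbit of [x], the pair [(z, x)] belongs to the
orbit-closure relation; being closed, the relation keeps these pairs when [z]
ranges over the closure of the orbit. *)
Lemma closure_orbit_sym x y : R_closed a [set: G] ->
  closure (orbit a [set: G] x) y -> closure (orbit a [set: G] y) x.
Proof.
move=> RG; suff : closure (orbit a [set: G] x) `<=`
    (fun z => (z, x)) @^-1` [set p | closure (orbit a [set: G] p.1) p.2].
  exact.
rewrite closureE; apply: smallest_sub.
  apply: preimage_closed RG => z _.
  by apply: cvg_pair; [exact: cvg_id | exact: cvg_cst].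
move=> _ [g _ <-] /=; apply: subset_closure.
by exists g^-1%g; rewrite ?actK.
Qed.

Section Subgroup.
Variable H : groupClosed G.
Local Notation cosets := (range (left_coset [set` H])).
Local Notation orbH := (orbit a [set` H]).

Lemma closure_orbit_subgroup x :
  closure (orbH x) `<=` closure (orbit a [set: G] x).
Proof. by apply: closureS => _ [h _ <-]; exists h. Qed.

Lemma closure_orbit_act h x y : h \in H ->
  closure (orbH x) y -> closure (orbH x) (a h y).
Proof.
move=> Hh /(@act_closure h); apply: closureS => _ [_ [k Hk <-] <-].
by exists (h * k)%g; [exact: gpredM | rewrite actM].
Qed.

Lemma closure_orbit_trans x y :
  closure (orbH x) y -> closure (orbH y) `<=` closure (orbH x).
Proof.
move=> xy; rewrite [X in X `<=` _]closureE; apply: smallest_sub.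
  exact: closed_closure.
by move=> _ [h Hh <-]; exact: closure_orbit_act.
Qed.

Hypothesis finH : finite_index H.

Lemma closure_orbit_cosets x : closure (orbit a [set: G] x) =
  \bigcup_(C in cosets) closure (orbit a C x).
Proof.
apply/seteqP; split; last first.
  by move=> y [C _]; apply: closureS => _ [g _ <-]; exists g.
rewrite [X in X `<=` _]closureE; apply: smallest_sub.
  by apply: closed_bigcup finH _ => C _; exact: closed_closure.
move=> _ [g _ <-]; exists (left_coset [set` H] g); first by exists g.
apply: subset_closure; exists g => //.
by exists 1%g; [exact: gpred1 | rewrite mulg1].
Qed.

Lemma R_closed_overgroup : R_closed a [set` H] -> R_closed a [set: G].
Proof.
move=> RH; rewrite /R_closed.
under eq_set do rewrite closure_orbit_cosets.
rewrite (_ : [set _ | _] =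
  \bigcup_(C in cosets) [set p : X * X | closure (orbit a C p.1) p.2])//.
apply: closed_bigcup finH _ => _ [g _ <-].
under eq_set do rewrite (propext (closure_orbit_left_coset _ _ _ _)).
apply: (@preimage_closed _ _ (fun p : X * X => (p.1, a g^-1%g p.2)) _ _ RH).
move=> p _; apply: cvg_pair; first exact: cvg_fst.
apply: (@continuous_comp _ _ _ snd (a g^-1%g)); first exact: cvg_snd.
exact: continuous_act.
Qed.

Hypothesis normH : normal_subgroup H.

Lemma closure_orbit_normal g x y :
  closure (orbH x) y -> closure (orbH (a g x)) (a g y).
Proof.
move=> /(@act_closure g); apply: closureS => _ [_ [h Hh <-] <-].
exists (h ^ g^-1)%g; first exact: normH.
by rewrite -!actM; congr (a _ x); rewrite conjgE invgK mulgA mulgVK.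
Qed.

(** Symmetry for [G] gives [k x] in [closure (H y)] for some [k], hence in
[closure (H x)]. By normality [k] carries [closure (H x)] to
[closure (H (k x))], which is again inside [closure (H y)]; by iteration
[closure (H y)] contains all [k^n x] with [n > 0], among which one is in the
[H]-orbit of [x]. *)
Lemma closure_orbit_subgroup_sym x y : R_closed a [set: G] ->
  closure (orbH x) y -> closure (orbH y) x.
Proof.
move=> RG xy.
have := closure_orbit_sym RG (closure_orbit_subgroup xy).
rewrite closure_orbit_cosets => -[_ [g _ <-]].
move=> /closure_orbit_left_coset; set k := (g^-1)%g => ykx.
have yknx n : closure (orbH y) (a (k ^+ n.+1)%g x).
  elim: n => [|n /(closure_orbit_trans xy)/(@closure_orbit_normal k _ _)].
    by rewrite expg1.
  by rewrite -actM -expgS; exact: closure_orbit_trans.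
have [n Hkn] := finite_index_expg k finH.
rewrite -(actK (k ^+ n.+1)%g x); apply: closure_orbit_act => //.
by rewrite gpredV.
Qed.

(** By normality each piece [closure (gH x)] is the [H]-orbit closure of [g x].
These are classes of an equivalence relation, so each one is inside
[closure (H x)] or disjoint from it, and the difference is the union of the
finitely many disjoint ones. *)
Lemma closed_closure_orbitD x : R_closed a [set: G] ->
  closed (closure (orbit a [set: G] x) `\` closure (orbH x)).
Proof.
move=> RG; pose other C := closure (orbit a C x) `<=` ~` closure (orbH x).
suff -> : closure (orbit a [set: G] x) `\` closure (orbH x) =
    \bigcup_(C in cosets `&` other) closure (orbit a C x).
  apply: closed_bigcup; first exact: finite_setIl.
  by move=> C _; exact: closed_closure.
rewrite closure_orbit_cosets; apply/seteqP; split; last first.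
  by move=> y [C [CH oC] Cy]; split; [exists C | exact: oC].
move=> y [[C CH Cy] nxy]; exists C => //; split => //.
case: CH Cy => g _ <- /closure_orbit_left_coset xy z.
move=> /closure_orbit_left_coset xz xz'; apply: nxy.
apply: closure_orbit_trans xz' _ _.
rewrite -[z](actVK g) -[y](actVK g); apply: closure_orbit_normal.
exact: closure_orbit_trans (closure_orbit_subgroup_sym RG xz) _ xy.
Qed.

End Subgroup.
End OrbitClosures.

Lemma disjoint_open_separated (X : topologicalType) (U V : set X) :
  open U -> open V -> U `&` V = set0 -> separated U V.
Proof.
have dis A B : open B -> A `&` B = set0 -> closure A `&` B = set0.
  move=> oB AB; rewrite -subset0 => z [Az Bz].
  by have [w] := Az B (open_nbhs_nbhs (conj oB Bz)); rewrite AB.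
move=> oU oV UV; split; first exact: dis.
by rewrite setIC; apply: dis; rewrite // setIC.
Qed.

Lemma R_closed_normal_subgroup (G : topologicalGroupType) (X : topologicalType)
    (a : continuous_action G X) (H : groupClosed G) :
  locally_connected X -> compact [set: X] -> hausdorff_space X ->
  normal_subgroup H -> finite_index H ->
  R_closed a [set: G] -> R_closed a [set` H].
Proof.
move=> lcX cX hX normH finH RG; rewrite /R_closed -openC openE => -[x y] /= nxy.
(* A pair outside the closed relation of [G] is interior to the complement of
   the smaller relation of [H]; only [y] in [closure (G x)] is at issue. *)
have [xGy|nxGy] := pselect (closure (orbit a [set: G] x) y); last first.
  have : nbhs (x, y) (~` [set p | closure (orbit a [set: G] p.1) p.2]).
    by apply: open_nbhs_nbhs; split => //; exact: closed_openC.
  by apply: filterS => -[z w] /= + /closure_orbit_subgroup.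
set A := closure (orbit a [set` H] x) in nxy *.
set B := closure (orbit a [set: G] x) `\` A.
have clB : closed B by exact: closed_closure_orbitD.
have [C /set_nbhsP[U [oU AU UC]] CB] : filter_from (set_nbhs A) closure (~` B).
  apply: (@compact_normal X hX cX A (@closed_closure _ _)); apply/set_nbhsP.
  by exists (~` B); split => //; [exact: closed_openC | move=> z Az [_]].
pose V := ~` closure C.
have BV : B `<=` V by move=> z Bz /CB.
have oV : open V by exact/closed_openC/closed_closure.
have UV : U `<=` closure C by exact: subset_trans UC (@subset_closure _ _).
have UV0 : U `&` V = set0 by rewrite -subset0 => z [/UV].
have GUV : closure (orbit a [set: G] x) `<=` U `|` V.
  move=> z xGz; have [/AU|nAz] := pselect (A z); first by left.
  by right; exact: BV.
have /lcX[W [oW cW Wx WUV]] := closure_orbit_near cX RG (openU oU oV) GUV.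
(* [h W] is connected, covered by [U] and [V], and meets [U] at [h x]. *)
have WU z h : W z -> h \in H -> U (a h z).
  move=> Wz Hh; have hWU : a h @` W `<=` U \/ a h @` W `<=` V.
    apply: connected_subset (disjoint_open_separated oU oV UV0) _ _.
      move=> _ [w Ww <-]; apply: (WUV w Ww); apply: subset_closure.
      by exists h.
    apply: connected_continuous_connected cW _.
    exact/continuous_subspaceT/continuous_act.
  have Uhx : U (a h x) by apply/AU/subset_closure; exists h.
  case: hWU => hW; first by apply: hW; exists z.
  have Vhx : V (a h x) by apply: hW; exists x.
  by exfalso; exact: (Vhx (UV _ Uhx)).
(* [V] is the complement of [closure C], and [H W] lies in [U], inside
   [closure C]; so the orbit closures starting in [W] miss [V]. *)
exists (W, V) => /=.
  by split; apply: open_nbhs_nbhs; split => //; exact: BV.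
move=> [z w] [/= Wz Vw] zw; apply: Vw.
move: zw; rewrite closureE; apply.
by split; [exact: closed_closure | move=> _ [h Hh <-]; exact/UV/WU].
Qed.

Unset Implicit Arguments.

Theorem theorem4 (G : topologicalGroupType) (X : topologicalType)
    (a : continuous_action G X) (H : groupClosed G)
    (X_locally_connected : locally_connected X)
    (X_compact : compact [set: X])
    (X_hausdorff : hausdorff_space X)
    (H_normal : normal_subgroup H)
    (H_finite_index : finite_index H) :
  R_closed a [set: G] <-> R_closed a [set` H].
Proof.
split; first exact: R_closed_normal_subgroup.
exact: R_closed_overgroup.
Qed.
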